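(* Let $X$ be a Banach space, $\tau:\mathcal D\to\mathcal D$ injective, $0<p\le2$ and $0<q\le p$. Then $$\|T_{\tau,q}\otimes\mathrm{Id}_X\|_q\le A_q\,C_1^{\frac1q-\frac1p}\,\|T_{\tau,p}\otimes\mathrm{Id}_X\|_p,$$ where $C_1=\sup_{\mathcal H\subseteq\tau(\mathcal D)}\frac{1}{|\sigma(\mathcal H)^*|}\int_0^1\mu_{\mathcal H}(t)\,dt$ and $A_q>0$ depends only on $q$ (through the constants of the atomic decomposition of $H^q_X$).
   Context: $\mathcal D$ is the collection of dyadic subintervals $[(k-1)2^{-n},k2^{-n})$ ($n\ge0$, $1\le k\le 2^n$) of $[0,1)$, $|I|$ Lebesgue measure; for a collection $\mathcal E$, $\mathcal E^*=\bigcup_{I\in\mathcal E}I$. $h_I$ is the Haar function ($1$ on the left half of $I$, $-1$ on the right half, $0$ outside). $\sigma=\tau^{-1}:\tau(\mathcal D)\to\mathcal D$, and for $\mathcal H\subseteq\tau(\mathcal D)$, $\mu_{\mathcal H}(t)=\sup_{I\in\mathcal H}\frac{|\sigma(I)|}{|I|}\mathbf 1_I(t)$. For a finite $X$-valued Haar series $f=\sum_Ix_Ih_I$ let $\mathbb S(f)(t)=\big(\int_0^1\|\sum_Ir_I(s)x_Ih_I(t)\|_X^2ds\big)^{1/2}$ with $(r_I)$ independent Rademacher functions, and $\|f\|_{H^p_X}=\|\mathbb S(f)\|_{L^p[0,1]}$ ($0<p<\infty$); $H^p_X$ is the completion. The rearrangement operator is $(T_{\tau,p}\otimes\mathrm{Id}_X)(\sum_Ix_Ih_I)=\sum_Ix_I(|I|/|\tau(I)|)^{1/p}h_{\tau(I)}$,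 and $\|T_{\tau,p}\otimes\mathrm{Id}_X\|_p$ is the supremum of $\|(T_{\tau,p}\otimes\mathrm{Id}_X)f\|_{H^p_X}$ over all $f$ with finite Haar support and $\|f\|_{H^p_X}\le1$. *)

(* Defs.v *)
From Stdlib Require Import Reals Lra Lia List.
Import ListNotations.
Open Scope R_scope.

Record BanachSpace := {
  bcar :> Type;
  bzero : bcar;
  badd : bcar -> bcar -> bcar;
  bopp : bcar -> bcar;
  bscal : R -> bcar -> bcar;
  bnorm : bcar -> R;
  badd_assoc : forall x y z, badd x (badd y z) = badd (badd x y) z;
  badd_comm : forall x y, badd x y = badd y x;
  badd_zero_r : forall x, badd x bzero = x;
  badd_opp_r : forall x, badd x (bopp x) = bzero;
  bscal_assoc : forall a b x, bscal a (bscal b x) = bscal (a * b) x;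
  bscal_one : forall x, bscal 1 x = x;
  bscal_distr_l : forall a x y, bscal a (badd x y) = badd (bscal a x) (bscal a y);
  bscal_distr_r : forall a b x, bscal (a + b) x = badd (bscal a x) (bscal b x);
  bnorm_eq0 : forall x, bnorm x = 0 -> x = bzero;
  bnorm_scal : forall a x, bnorm (bscal a x) = Rabs a * bnorm x;
  bnorm_triangle : forall x y, bnorm (badd x y) <= bnorm x + bnorm y;
  bcomplete : forall u : nat -> bcar,
    (forall eps, 0 < eps -> exists N, forall m n, (N <= m)%nat -> (N <= n)%nat ->
        bnorm (badd (u m) (bopp (u n))) < eps) ->
    exists l, forall eps, 0 < eps -> exists N, forall n, (N <= n)%nat ->
        bnorm (badd (u n) (bopp l)) < eps
}.

(** * Dyadic intervals: mkDyad n k _ is [k 2^-n, (k+1) 2^-n), 0 <= k < 2^n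
    (k is zero-based; the paper's k corresponds to k+1). *)
Record dyad := mkDyad {
  dlev : nat;
  dpos : nat;
  dpos_lt : Nat.ltb dpos (2 ^ dlev)%nat = true
}.

Definition dlen (I : dyad) : R := / 2 ^ dlev I.
Definition dleft (I : dyad) : R := INR (dpos I) * dlen I.

Definition in_dyadb (I : dyad) (t : R) : bool :=
  if Rle_dec (dleft I) t then
    if Rlt_dec t (dleft I + dlen I) then true else false
  else false.

Definition haar (I : dyad) (t : R) : R :=
  if Rle_dec (dleft I) t then
    if Rlt_dec t (dleft I + dlen I / 2) then 1
    else if Rlt_dec t (dleft I + dlen I) then -1 else 0
  else 0.

(** x^a for x >= 0 with the convention 0^a = 0 (a > 0). *)
Definition rpow (x a : R) : R := if Rle_dec x 0 then 0 else Rpower x a.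

Definition Rsum (l : list R) : R := fold_right Rplus 0 l.

(** Exact integral over [0,1] of a function constant on each dyadic
    interval of level m (evaluated at midpoints). *)
Definition dyadic_int (m : nat) (g : R -> R) : R :=
  Rsum (map (fun j => g ((INR j + / 2) / 2 ^ m) / 2 ^ m) (seq 0 (2 ^ m)%nat)).

Definition maxlev (l : list dyad) : nat := fold_right Nat.max 0%nat (map dlev l).

(** * Finite X-valued Haar series: a list of pairs (I, x_I) with distinct I,
    representing sum_I x_I h_I. *)
Definition haar_series (X : BanachSpace) := list (dyad * X).
Definition valid_series {X : BanachSpace} (f : haar_series X) : Prop :=
  NoDup (map fst f).

Definition vsum (X : BanachSpace) (l : list X) : X := fold_right (badd X) (bzero X) l.

Fixpoint sign_lists (n : nat) : list (list R) :=
  match n with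
  | O => [ [] ]
  | S n' => flat_map (fun s => [1 :: s; -1 :: s]) (sign_lists n')
  end.

Definition signed_eval (X : BanachSpace) (f : haar_series X) (eps : list R) (t : R) : X :=
  vsum X (map (fun ex => bscal X (fst ex * haar (fst (snd ex)) t) (snd (snd ex)))
              (combine eps f)).

(** Square function S(f)(t): the Rademacher integral over s in [0,1] equals the
    average over all sign choices (r_I independent, symmetric +-1). *)
Definition Sfun (X : BanachSpace) (f : haar_series X) (t : R) : R :=
  sqrt (Rsum (map (fun eps => (bnorm X (signed_eval X f eps t)) ^ 2)
                  (sign_lists (length f))) / 2 ^ (length f)).

(** ||f||_{H^p_X} = ||S(f)||_{L^p[0,1]}; S(f) is constant on dyadic intervals
    of level 1 + (max level in the support). *)
Definition Hnorm (X : BanachSpace) (p : R) (f : haar_series X) : R :=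
  rpow (dyadic_int (S (maxlev (map fst f))) (fun t => rpow (Sfun X f t) p)) (/ p).

Definition rearr (X : BanachSpace) (tau : dyad -> dyad) (p : R) (f : haar_series X)
  : haar_series X :=
  map (fun Ix => (tau (fst Ix),
                  bscal X (rpow (dlen (fst Ix) / dlen (tau (fst Ix))) (/ p)) (snd Ix))) f.

Definition opbound (X : BanachSpace) (tau : dyad -> dyad) (p M : R) : Prop :=
  forall f : haar_series X, valid_series f -> Hnorm X p f <= 1 ->
    Hnorm X p (rearr X tau p f) <= M.

(** For a finite H = tau(G) (G = sigma(H)): mu_H(t). *)
Definition mu (tau : dyad -> dyad) (G : list dyad) (t : R) : R :=
  fold_right Rmax 0
    (map (fun I => if in_dyadb (tau I) t then dlen I / dlen (tau I) else 0) G).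

Definition union_meas (G : list dyad) : R :=
  dyadic_int (maxlev G) (fun t => if existsb (fun I => in_dyadb I t) G then 1 else 0).

Definition C1_bound (tau : dyad -> dyad) (M : R) : Prop :=
  forall G : list dyad, G <> [] ->
    dyadic_int (maxlev (map tau G)) (mu tau G) / union_meas G <= M.

(* Main.v *)
Require Import Defs.
From Stdlib Require Import Reals RList Lra Lia List Bool.
Import ListNotations.
Open Scope R_scope.

(** For a Haar series [f] let [s I] be the constant value on [I] of the square
    function of the part of [f] supported on the dyadic intervals containing
    [I], so that [s I <= S(f)] on [I], and put [a = q / p <= 1].  The series
    [g = sum_I a (s I)^(a - 1) x_I h_I] satisfies [S(g) <= S(f)^a] pointwise:
    along the chain of intervals containing a point this is summation by parts
    against the increasing sequence [s I], since [a s^(a - 1)] is the derivative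
    of [s^a].  Hence [||g||_p <= ||f||_q^a].

    Conversely the contraction principle gives
    [S(T_q f) <= (p / q) N^(1/q - 1/p) S(T_p g)], where [N (t)] is the maximum of
    [(s I)^q |I| / |tau I|] over the [I] with [t] in [tau I].  Applying the
    definition of [C_1] to the collections [{I : s I > c}] and integrating over
    the levels gives [int N <= C_1 int S(f)^q], and Hölder's inequality concludes
    with [A_q = 2 / q]. *)

(** * Powers *)

Lemma rpow_pos_eq (x a : R) : 0 < x -> rpow x a = Rpower x a.
Proof. intros Hx; unfold rpow; destruct (Rle_dec x 0); [lra | reflexivity]. Qed.

Lemma rpow_nonpos_eq (x a : R) : x <= 0 -> rpow x a = 0.
Proof. intros Hx; unfold rpow; destruct (Rle_dec x 0); [reflexivity | lra]. Qed.

Lemma rpow_pos (x a : R) : 0 < x -> 0 < rpow x a.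
Proof. intros Hx; rewrite rpow_pos_eq by assumption; apply exp_pos. Qed.

Lemma rpow_nonneg (x a : R) : 0 <= rpow x a.
Proof.
  destruct (Rle_lt_dec x 0);
    [rewrite rpow_nonpos_eq by assumption; lra | left; apply rpow_pos; assumption].
Qed.

Lemma rpow_le_Rpower (x a : R) : rpow x a <= Rpower x a.
Proof. unfold rpow; destruct (Rle_dec x 0); [left; apply exp_pos | lra]. Qed.

Lemma rpow_le (x y a : R) : 0 <= a -> x <= y -> rpow x a <= rpow y a.
Proof.
  intros Ha Hxy; destruct (Rle_lt_dec x 0).
  - rewrite (rpow_nonpos_eq x) by assumption; apply rpow_nonneg.
  - rewrite !rpow_pos_eq by lra; apply Rle_Rpower_l; lra.
Qed.

Lemma rpow_nonpos_exponent_le (x y a : R) : a <= 0 -> 0 < x <= y -> rpow y a <= rpow x a.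
Proof.
  intros Ha Hxy; rewrite !rpow_pos_eq by lra.
  rewrite <- (Ropp_involutive a), !(Rpower_Ropp _ (- a)).
  apply Rinv_le_contravar; [apply exp_pos | apply Rle_Rpower_l; lra].
Qed.

Lemma rpow_0_r (x : R) : 0 < x -> rpow x 0 = 1.
Proof. intros Hx; rewrite rpow_pos_eq by assumption; apply Rpower_O; assumption. Qed.

Lemma rpow_1_r (x : R) : 0 <= x -> rpow x 1 = x.
Proof.
  intros [Hx | <-].
  - rewrite rpow_pos_eq by assumption; apply Rpower_1; assumption.
  - apply rpow_nonpos_eq; lra.
Qed.

Lemma rpow_1_l (a : R) : rpow 1 a = 1.
Proof. rewrite rpow_pos_eq by lra; unfold Rpower; rewrite ln_1, Rmult_0_r; apply exp_0. Qed.

Lemma rpow_rpow (x a b : R) : rpow (rpow x a) b = rpow x (a * b).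
Proof.
  destruct (Rle_lt_dec x 0).
  - rewrite !(rpow_nonpos_eq x), rpow_nonpos_eq by lra; reflexivity.
  - rewrite rpow_pos_eq by (apply rpow_pos; assumption).
    rewrite !rpow_pos_eq by assumption; apply Rpower_mult.
Qed.

Lemma rpow_plus (x a b : R) : rpow x (a + b) = rpow x a * rpow x b.
Proof.
  destruct (Rle_lt_dec x 0).
  - rewrite !rpow_nonpos_eq by assumption; ring.
  - rewrite !rpow_pos_eq by assumption; apply Rpower_plus.
Qed.

Lemma rpow_mult_distr (x y a : R) : 0 <= x -> 0 <= y -> rpow (x * y) a = rpow x a * rpow y a.
Proof.
  intros [Hx | <-] [Hy | <-]; rewrite ?Rmult_0_l, ?Rmult_0_r, ?(rpow_nonpos_eq 0) by lra;
    try ring.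
  rewrite !rpow_pos_eq by (try apply Rmult_lt_0_compat; assumption).
  symmetry; apply Rpower_mult_distr; assumption.
Qed.

Lemma exp_tangent (c z : R) : 0 < z -> exp c * (1 + (ln z - c)) <= z.
Proof.
  intros Hz; rewrite <- (exp_ln z Hz) at 2.
  replace (ln z) with (c + (ln z - c)) at 2 by ring; rewrite exp_plus.
  apply Rmult_le_compat_l; [left; apply exp_pos | apply exp_ineq1_le].
Qed.

Lemma weighted_AM_GM (x y a : R) : 0 <= x -> 0 <= y -> 0 <= a <= 1 ->
  rpow x (1 - a) * rpow y a <= (1 - a) * x + a * y.
Proof.
  intros Hx Hy Ha.
  assert (Hmean : 0 <= (1 - a) * x + a * y)
    by (apply Rplus_le_le_0_compat; apply Rmult_le_pos; lra).
  destruct Hx as [Hx | <-]; [| rewrite rpow_nonpos_eq, Rmult_0_l by lra; assumption].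
  destruct Hy as [Hy | <-];
    [| rewrite (rpow_nonpos_eq 0), Rmult_0_r by lra; assumption].
  rewrite !rpow_pos_eq by assumption; unfold Rpower; rewrite <- exp_plus.
  set (c := (1 - a) * ln x + a * ln y).
  assert (Hx' := Rmult_le_compat_l (1 - a) _ _ ltac:(lra) (exp_tangent c x Hx)).
  assert (Hy' := Rmult_le_compat_l a _ _ ltac:(lra) (exp_tangent c y Hy)).
  replace (exp c) with ((1 - a) * (exp c * (1 + (ln x - c)))
                        + a * (exp c * (1 + (ln y - c))))
    by (unfold c; ring).
  lra.
Qed.

Lemma rpow_tangent (x y a : R) : 0 <= x <= y -> 0 <= a <= 1 ->
  a * rpow y (a - 1) * (y - x) <= rpow y a - rpow x a.
Proof.
  intros Hxy Ha.
  destruct (Rle_lt_dec y 0).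
  - rewrite !rpow_nonpos_eq by lra; lra.
  - assert (Hmean := weighted_AM_GM y x a ltac:(lra) ltac:(lra) Ha).
    apply (Rmult_le_compat_l (rpow y (a - 1))) in Hmean; [| apply rpow_nonneg].
    rewrite <- Rmult_assoc, <- rpow_plus in Hmean.
    replace (a - 1 + (1 - a)) with 0 in Hmean by ring.
    rewrite rpow_0_r, Rmult_1_l in Hmean by assumption.
    replace (rpow y a) with (rpow y (a - 1) * y); [lra |].
    rewrite <- (rpow_1_r y) at 2 by lra; rewrite <- rpow_plus; f_equal; ring.
Qed.

Lemma rpow_holder2 (x y x' y' a : R) :
  0 <= x -> 0 <= y -> 0 <= x' -> 0 <= y' -> 0 <= a <= 1 ->
  rpow x (1 - a) * rpow y a + rpow x' (1 - a) * rpow y' a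
  <= rpow (x + x') (1 - a) * rpow (y + y') a.
Proof.
  intros Hx Hy Hx' Hy' Ha.
  destruct (Req_dec (x + x') 0) as [HX | HX].
  { rewrite !(rpow_nonpos_eq _ (1 - a)) by lra; lra. }
  destruct (Req_dec (y + y') 0) as [HY | HY].
  { rewrite !(rpow_nonpos_eq _ a) by lra; lra. }
  assert (Hnormalized : forall u v, 0 <= u -> 0 <= v ->
    rpow u (1 - a) * rpow v a <= rpow (x + x') (1 - a) * rpow (y + y') a
                                 * ((1 - a) * (u / (x + x')) + a * (v / (y + y')))).
  { intros u v Hu Hv.
    assert (Hu' : 0 <= u / (x + x')) by (apply Rle_mult_inv_pos; lra).
    assert (Hv' : 0 <= v / (y + y')) by (apply Rle_mult_inv_pos; lra).
    replace u with ((x + x') * (u / (x + x'))) at 1 by (field; lra).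
    replace v with ((y + y') * (v / (y + y'))) at 1 by (field; lra).
    rewrite !rpow_mult_distr by lra.
    assert (Hmean := weighted_AM_GM _ _ a Hu' Hv' Ha).
    apply (Rmult_le_compat_l (rpow (x + x') (1 - a) * rpow (y + y') a)) in Hmean;
      [lra | apply Rmult_le_pos; apply rpow_nonneg]. }
  eapply Rle_trans; [apply Rplus_le_compat; apply Hnormalized; assumption |].
  apply Req_le; field; lra.
Qed.

(** * Finite sums *)

Section Sums.
Context {A : Type}.
Implicit Types (l : list A) (F G : A -> R).

Lemma Rsum_map_le l F G : (forall x, In x l -> F x <= G x) ->
  Rsum (map F l) <= Rsum (map G l).
Proof.
  induction l as [| x l IH]; simpl; intros HFG; [lra |].
  apply Rplus_le_compat; [apply HFG; auto | apply IH; auto].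
Qed.

Lemma Rsum_map_plus l F G :
  Rsum (map (fun x => F x + G x) l) = Rsum (map F l) + Rsum (map G l).
Proof. induction l as [| x l IH]; simpl; [| rewrite IH]; ring. Qed.

Lemma Rsum_map_scal l F c : Rsum (map (fun x => c * F x) l) = c * Rsum (map F l).
Proof. induction l as [| x l IH]; simpl; [| rewrite IH]; ring. Qed.

Lemma Rsum_map_nonneg l F : (forall x, 0 <= F x) -> 0 <= Rsum (map F l).
Proof.
  intros HF; induction l as [| x l IH]; simpl; [lra |].
  apply Rplus_le_le_0_compat; [apply HF | apply IH].
Qed.

Lemma le_Rsum_map l F x : (forall y, 0 <= F y) -> In x l -> F x <= Rsum (map F l).
Proof.
  intros HF; induction l as [| y l IH]; simpl; [tauto |].
  assert (Htail := Rsum_map_nonneg l F HF).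
  intros [-> | Hx]; [lra | specialize (IH Hx); specialize (HF y); lra].
Qed.

Lemma Rsum_map_holder l F G (a : R) :
  (forall x, 0 <= F x) -> (forall x, 0 <= G x) -> 0 <= a <= 1 ->
  Rsum (map (fun x => rpow (F x) (1 - a) * rpow (G x) a) l)
  <= rpow (Rsum (map F l)) (1 - a) * rpow (Rsum (map G l)) a.
Proof.
  intros HF HG Ha; induction l as [| x l IH]; simpl.
  - apply Rmult_le_pos; apply rpow_nonneg.
  - eapply Rle_trans; [apply Rplus_le_compat_l, IH |].
    apply rpow_holder2; auto using Rsum_map_nonneg.
Qed.
End Sums.

Lemma Rsum_app (l l' : list R) : Rsum (l ++ l') = Rsum l + Rsum l'.
Proof. induction l as [| x l IH]; simpl; [| rewrite IH]; ring. Qed.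

Lemma Rsum_map_seq_double (F : nat -> R) n :
  Rsum (map F (seq 0 (2 * n))) = Rsum (map (fun j => F (2 * j)%nat + F (S (2 * j))) (seq 0 n)).
Proof.
  induction n as [| n IH]; [reflexivity |].
  replace (2 * S n)%nat with (S (S (2 * n))) by lia.
  rewrite !seq_S, !map_app, !Rsum_app, IH; simpl; ring.
Qed.

(** * Dyadic integrals *)

Lemma pow2_pos (n : nat) : 0 < 2 ^ n.
Proof. apply pow_lt; lra. Qed.

Lemma dyadic_int_le m (g h : R -> R) : (forall t, g t <= h t) ->
  dyadic_int m g <= dyadic_int m h.
Proof.
  intros Hgh; apply Rsum_map_le; intros j _.
  apply Rmult_le_compat_r; [left; apply Rinv_0_lt_compat, pow2_pos | apply Hgh].
Qed.

Lemma dyadic_int_plus m (g h : R -> R) :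
  dyadic_int m (fun t => g t + h t) = dyadic_int m g + dyadic_int m h.
Proof.
  unfold dyadic_int; rewrite <- Rsum_map_plus; f_equal.
  apply map_ext; intros j; apply Rdiv_plus_distr.
Qed.

Lemma dyadic_int_scal m c (g : R -> R) : dyadic_int m (fun t => c * g t) = c * dyadic_int m g.
Proof.
  unfold dyadic_int; rewrite <- Rsum_map_scal; f_equal.
  apply map_ext; intros j; apply Rmult_assoc.
Qed.

Lemma dyadic_int_nonneg m (g : R -> R) : (forall t, 0 <= g t) -> 0 <= dyadic_int m g.
Proof.
  intros Hg; apply Rsum_map_nonneg; intros j.
  apply Rle_mult_inv_pos; [apply Hg | apply pow2_pos].
Qed.

Lemma dyadic_int_holder m (g h : R -> R) (a : R) :
  (forall t, 0 <= g t) -> (forall t, 0 <= h t) -> 0 <= a <= 1 ->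
  dyadic_int m (fun t => rpow (g t) (1 - a) * rpow (h t) a)
  <= rpow (dyadic_int m g) (1 - a) * rpow (dyadic_int m h) a.
Proof.
  intros Hg Hh Ha; assert (Hcell := Rinv_0_lt_compat _ (pow2_pos m)).
  assert (Hsplit : rpow (/ 2 ^ m) (1 - a) * rpow (/ 2 ^ m) a = / 2 ^ m).
  { rewrite <- rpow_plus; replace (1 - a + a) with 1 by ring; apply rpow_1_r; lra. }
  eapply Rle_trans; [apply Req_le | apply Rsum_map_holder; try assumption];
    [| intros j; apply Rmult_le_pos; auto; lra ..].
  unfold dyadic_int; f_equal; apply map_ext; intros j.
  generalize ((INR j + / 2) / 2 ^ m); intros t; unfold Rdiv.
  rewrite !rpow_mult_distr by (auto; lra); rewrite <- Hsplit at 1; ring.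
Qed.

Definition same_cell (m : nat) (t u : R) : Prop :=
  exists j : nat, INR j <= t * 2 ^ m < INR j + 1 /\ INR j <= u * 2 ^ m < INR j + 1.

Definition dyadic_step (m : nat) (g : R -> R) : Prop :=
  forall t u, same_cell m t u -> g t = g u.

Lemma same_cell_coarser m m' t u : (m <= m')%nat -> same_cell m' t u -> same_cell m t u.
Proof.
  intros Hm; induction Hm as [| m' _ IH]; [auto |].
  intros [j [Ht Hu]]; apply IH; exists (Nat.div2 j); simpl in Ht, Hu.
  assert (Hj := Nat.div2_odd j); apply (f_equal INR) in Hj.
  rewrite plus_INR, mult_INR in Hj; simpl (INR 2) in Hj.
  destruct (Nat.odd j); simpl (INR (Nat.b2n _)) in Hj; lra.
Qed.

Lemma dyadic_int_succ m (g : R -> R) : dyadic_step m g -> dyadic_int (S m) g = dyadic_int m g.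
Proof.
  intros Hg; unfold dyadic_int.
  replace (2 ^ S m)%nat with (2 * 2 ^ m)%nat by (simpl; lia).
  rewrite Rsum_map_seq_double; f_equal; apply map_ext; intros j.
  assert (Hpow2 := pow2_pos m); rewrite S_INR, mult_INR; simpl (INR 2); simpl (2 ^ S m).
  assert (Hmidpoint : forall c, 0 <= c < 1 ->
            g ((INR j + c) / 2 ^ m) = g ((INR j + / 2) / 2 ^ m)).
  { intros c Hc; apply Hg; exists j; unfold Rdiv.
    rewrite !Rmult_assoc, Rinv_l, !Rmult_1_r by lra; lra. }
  replace (((1 + 1) * INR j + / 2) / (2 * 2 ^ m)) with ((INR j + / 4) / 2 ^ m) by (field; lra).
  replace (((1 + 1) * INR j + 1 + / 2) / (2 * 2 ^ m)) with ((INR j + 3 / 4) / 2 ^ m)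
    by (field; lra).
  rewrite (Hmidpoint (/ 4)), (Hmidpoint (3 / 4)) by lra; field; lra.
Qed.

Lemma dyadic_int_refine m m' (g : R -> R) : dyadic_step m g -> (m <= m')%nat ->
  dyadic_int m' g = dyadic_int m g.
Proof.
  intros Hg Hm; induction Hm as [| m' Hm IH]; [reflexivity |].
  rewrite dyadic_int_succ; [assumption |].
  intros t u Htu; apply Hg, (same_cell_coarser m m'); assumption.
Qed.

(** * Dyadic intervals *)

Lemma dlen_pos I : 0 < dlen I.
Proof. apply Rinv_0_lt_compat, pow2_pos. Qed.

Lemma dlen_ratio_pos I J : 0 < dlen I / dlen J.
Proof. apply Rdiv_lt_0_compat; apply dlen_pos. Qed.

Lemma in_dyadb_iff I t :
  in_dyadb I t = true <-> INR (dpos I) <= t * 2 ^ dlev I < INR (dpos I) + 1.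
Proof.
  assert (Hl := dlen_pos I); set (u := t * 2 ^ dlev I).
  assert (Ht : t = u * dlen I)
    by (unfold u, dlen; field; apply Rgt_not_eq, pow2_pos).
  unfold in_dyadb.
  replace (dleft I + dlen I) with ((INR (dpos I) + 1) * dlen I) by (unfold dleft; ring).
  unfold dleft; rewrite Ht.
  destruct (Rle_dec _ _) as [Hle | Hle]; [destruct (Rlt_dec _ _) as [Hlt | Hlt] |].
  - apply Rmult_le_reg_r in Hle; [| assumption].
    apply Rmult_lt_reg_r in Hlt; [| assumption]; tauto.
  - split; [discriminate | intros [_ Hu]; destruct Hlt; apply Rmult_lt_compat_r; assumption].
  - split; [discriminate | intros [Hu _]; destruct Hle; apply Rmult_le_compat_r; lra].
Qed.

Lemma in_dyadb_dleft I : in_dyadb I (dleft I) = true.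
Proof.
  apply in_dyadb_iff; unfold dleft, dlen.
  rewrite Rmult_assoc, Rinv_l by apply Rgt_not_eq, pow2_pos; lra.
Qed.

Lemma in_dyadb_same_cell I m t u : (dlev I <= m)%nat -> same_cell m t u ->
  in_dyadb I t = in_dyadb I u.
Proof.
  intros Hm Htu; destruct (same_cell_coarser _ _ _ _ Hm Htu) as [j [Ht Hu]].
  assert (Hindex : forall s, INR j <= s * 2 ^ dlev I < INR j + 1 ->
            (in_dyadb I s = true <-> dpos I = j)).
  { intros s Hs; rewrite in_dyadb_iff; split; [| intros ->; assumption].
    rewrite <- !S_INR in *; intros Hs'.
    apply Nat.le_antisymm; apply Nat.lt_succ_r, INR_lt; lra. }
  apply eq_iff_eq_true; rewrite (Hindex t Ht), (Hindex u Hu); reflexivity.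
Qed.

Lemma in_dyadb_same_interval I J t u : (dlev J <= dlev I)%nat ->
  in_dyadb I t = true -> in_dyadb I u = true -> in_dyadb J t = in_dyadb J u.
Proof.
  rewrite !in_dyadb_iff; intros HJ Ht Hu.
  apply (in_dyadb_same_cell J (dlev I)); [assumption | exists (dpos I); auto].
Qed.

Lemma abs_haar I t : Rabs (haar I t) = if in_dyadb I t then 1 else 0.
Proof.
  unfold haar, in_dyadb; assert (Hl := dlen_pos I).
  destruct (Rle_dec (dleft I) t); [| apply Rabs_R0].
  destruct (Rlt_dec t (dleft I + dlen I / 2));
    destruct (Rlt_dec t (dleft I + dlen I)); try lra;
    [apply Rabs_R1 | rewrite Rabs_left; lra | apply Rabs_R0].
Qed.

Lemma dlen_le_dyadic_int_indicator I m : (dlev I <= m)%nat ->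
  dlen I <= dyadic_int m (fun t => if in_dyadb I t then 1 else 0).
Proof.
  intros Hm; rewrite (dyadic_int_refine (dlev I)); [| | assumption].
  2: { intros t u Htu; rewrite (in_dyadb_same_cell I (dlev I) t u); auto. }
  set (cell := fun j : nat => (if in_dyadb I ((INR j + / 2) / 2 ^ dlev I) then 1 else 0)
                              / 2 ^ dlev I).
  assert (Hpos := proj1 (Nat.ltb_lt _ _) (dpos_lt I)).
  assert (Hpow2 := pow2_pos (dlev I)).
  replace (dlen I) with (cell (dpos I)).
  - apply (le_Rsum_map _ cell); [| apply in_seq; lia].
    intros j; apply Rle_mult_inv_pos; [destruct (in_dyadb _ _); lra | assumption].
  - unfold cell; rewrite (proj2 (in_dyadb_iff _ _)); [apply Rmult_1_l |].
    unfold Rdiv; rewrite Rmult_assoc, Rinv_l by lra; lra.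
Qed.

Lemma dlev_le_maxlev I (G : list dyad) : In I G -> (dlev I <= maxlev G)%nat.
Proof.
  unfold maxlev; induction G as [| J G IH]; simpl; [tauto |].
  intros [-> | HI]; [| specialize (IH HI)]; lia.
Qed.

Lemma maxlev_incl (G H : list dyad) : incl G H -> (maxlev G <= maxlev H)%nat.
Proof.
  induction G as [| J G IH]; intros Hincl; [apply Nat.le_0_l |].
  apply incl_cons_inv in Hincl; destruct Hincl as [HJ HG].
  apply Nat.max_lub; [apply dlev_le_maxlev, HJ | apply IH, HG].
Qed.

(** * Rademacher averages *)

Lemma sqrt_mean_sq_triangle (x y x' y' : R) :
  sqrt (((x + x') ^ 2 + (y + y') ^ 2) / 2)
  <= sqrt ((x ^ 2 + y ^ 2) / 2) + sqrt ((x' ^ 2 + y' ^ 2) / 2).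
Proof.
  rewrite !sqrt_div_alt by lra; unfold Rdiv; rewrite <- Rmult_plus_distr_r.
  apply Rmult_le_compat_r; [left; apply Rinv_0_lt_compat, sqrt_lt_R0; lra |].
  assert (Htri := triangle (x + x') (y + y') 0 0 x' y').
  unfold dist_euc in Htri; rewrite !Rsqr_pow2, !Rminus_0_r in Htri.
  replace (x + x' - x') with x in Htri by ring; replace (y + y' - y') with y in Htri by ring.
  exact Htri.
Qed.

Lemma Rabs_le_factor (c d : R) : Rabs c <= Rabs d -> exists k, -1 <= k <= 1 /\ c = k * d.
Proof.
  intros Hcd; destruct (Req_dec d 0) as [-> | Hd].
  - exists 0; split; [lra |]; rewrite Rabs_R0 in Hcd.
    destruct (Req_dec c 0) as [-> | Hc]; [ring | apply Rabs_pos_lt in Hc; lra].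
  - exists (c / d); assert (Hc : c = c / d * d) by (field; assumption); split; [| assumption].
    revert Hcd; rewrite Hc at 1; unfold Rabs.
    destruct (Rcase_abs _), (Rcase_abs d); split; nra.
Qed.

Section BanachSpaceTheory.
Variable X : BanachSpace.
Implicit Types u v x y : X.

Lemma bscal_0_l x : bscal X 0 x = bzero X.
Proof. apply bnorm_eq0; rewrite bnorm_scal, Rabs_R0; ring. Qed.

Lemma bnorm_bzero : bnorm X (bzero X) = 0.
Proof. rewrite <- (bscal_0_l (bzero X)), bnorm_scal, Rabs_R0; ring. Qed.

Lemma bscal_bzero c : bscal X c (bzero X) = bzero X.
Proof. apply bnorm_eq0; rewrite bnorm_scal, bnorm_bzero; ring. Qed.

Lemma bnorm_nonneg x : 0 <= bnorm X x.
Proof.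
  assert (Htri := bnorm_triangle X (bscal X 1 x) (bscal X (Ropp 1) x)).
  rewrite <- bscal_distr_r, !bnorm_scal, Rplus_opp_r, Rabs_Ropp, Rabs_R0, Rabs_R1 in Htri; lra.
Qed.

Lemma badd_zero_l x : badd X (bzero X) x = x.
Proof. rewrite badd_comm; apply badd_zero_r. Qed.

Lemma badd_interchange u v x y :
  badd X (badd X u v) (badd X x y) = badd X (badd X u x) (badd X v y).
Proof.
  rewrite !badd_assoc; f_equal; rewrite <- !badd_assoc; f_equal; apply badd_comm.
Qed.
End BanachSpaceTheory.

Section Rademacher.
Context {X : BanachSpace} {A : Type}.
Implicit Types (f : list (A * X)) (a b : A -> R) (u v x y : X).

(* The mean of [|| v + sum_i r_i a_i x_i || ^ 2] over the signs [r_i], one sign at a time. *)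
Fixpoint rad_mean_sq f a v : R :=
  match f with
  | [] => bnorm X v ^ 2
  | (i, x) :: f' => (rad_mean_sq f' a (badd X v (bscal X (a i) x))
                     + rad_mean_sq f' a (badd X v (bscal X (- a i) x))) / 2
  end.

Definition rad_norm f a : R := sqrt (rad_mean_sq f a (bzero X)).

Lemma rad_mean_sq_nonneg f a v : 0 <= rad_mean_sq f a v.
Proof.
  revert v; induction f as [| [i x] f IH]; intros v; cbn [rad_mean_sq]; [apply pow2_ge_0 |].
  apply Rle_mult_inv_pos; [apply Rplus_le_le_0_compat; apply IH | lra].
Qed.

Lemma rad_norm_nonneg f a : 0 <= rad_norm f a.
Proof. apply sqrt_pos. Qed.

Lemma rad_mean_sq_scal f a c v :
  rad_mean_sq f (fun i => c * a i) (bscal X c v) = c ^ 2 * rad_mean_sq f a v.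
Proof.
  revert v; induction f as [| [i x] f IH]; intros v; cbn [rad_mean_sq].
  - rewrite bnorm_scal, Rpow_mult_distr, pow2_abs; reflexivity.
  - rewrite Ropp_mult_distr_r, <- !bscal_assoc, <- !bscal_distr_l, !IH; field.
Qed.

Lemma rad_norm_scal f a c : rad_norm f (fun i => c * a i) = Rabs c * rad_norm f a.
Proof.
  unfold rad_norm; rewrite <- (bscal_bzero X c), rad_mean_sq_scal.
  rewrite sqrt_mult_alt, bscal_bzero by apply pow2_ge_0.
  rewrite <- Rsqr_pow2, sqrt_Rsqr_abs; reflexivity.
Qed.

Lemma sqrt_rad_mean_sq_triangle f a b u v :
  sqrt (rad_mean_sq f (fun i => a i + b i) (badd X u v))
  <= sqrt (rad_mean_sq f a u) + sqrt (rad_mean_sq f b v).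
Proof.
  revert u v; induction f as [| [i x] f IH]; intros u v; cbn [rad_mean_sq].
  - rewrite !sqrt_pow2 by apply bnorm_nonneg; apply bnorm_triangle.
  - rewrite Ropp_plus_distr, !bscal_distr_r.
    rewrite (badd_interchange X u v (bscal X (a i) x)),
            (badd_interchange X u v (bscal X (- a i) x)).
    rewrite <- (pow2_sqrt (rad_mean_sq f a (badd X u (bscal X (a i) x)))),
            <- (pow2_sqrt (rad_mean_sq f a (badd X u (bscal X (- a i) x)))),
            <- (pow2_sqrt (rad_mean_sq f b (badd X v (bscal X (b i) x)))),
            <- (pow2_sqrt (rad_mean_sq f b (badd X v (bscal X (- b i) x))))
      by apply rad_mean_sq_nonneg.
    eapply Rle_trans; [apply sqrt_le_1_alt | apply sqrt_mean_sq_triangle].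
    apply Rmult_le_compat_r; [lra |].
    apply Rplus_le_compat; rewrite <- (pow2_sqrt (rad_mean_sq f (fun _ => _) _))
      by apply rad_mean_sq_nonneg; apply pow_incr; split; auto using sqrt_pos.
Qed.

Lemma rad_norm_triangle f a b :
  rad_norm f (fun i => a i + b i) <= rad_norm f a + rad_norm f b.
Proof.
  unfold rad_norm; rewrite <- (badd_zero_r X (bzero X)) at 1; apply sqrt_rad_mean_sq_triangle.
Qed.

Lemma rad_mean_sq_convex f a u v c : 0 <= c <= 1 ->
  rad_mean_sq f a (badd X (bscal X c u) (bscal X (1 - c) v))
  <= c * rad_mean_sq f a u + (1 - c) * rad_mean_sq f a v.
Proof.
  intros Hc; revert u v; induction f as [| [i x] f IH]; intros u v; cbn [rad_mean_sq].
  - assert (Htri := bnorm_triangle X (bscal X c u) (bscal X (1 - c) v)).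
    rewrite !bnorm_scal, !Rabs_pos_eq in Htri by lra.
    assert (Hsq := pow_incr _ _ 2 (conj (bnorm_nonneg X _) Htri)).
    assert (0 <= c * (1 - c) * (bnorm X u - bnorm X v) ^ 2)
      by (apply Rmult_le_pos; [apply Rmult_le_pos; lra | apply pow2_ge_0]).
    lra.
  - assert (Hshift : forall d, badd X (badd X (bscal X c u) (bscal X (1 - c) v)) (bscal X d x)
      = badd X (bscal X c (badd X u (bscal X d x)))
               (bscal X (1 - c) (badd X v (bscal X d x)))).
    { intros d; rewrite !bscal_distr_l, badd_interchange; f_equal.
      rewrite !bscal_assoc, <- bscal_distr_r; f_equal; ring. }
    rewrite !Hshift.
    assert (Hplus := IH (badd X u (bscal X (a i) x)) (badd X v (bscal X (a i) x))).
    assert (Hminus := IH (badd X u (bscal X (- a i) x)) (badd X v (bscal X (- a i) x))).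
    lra.
Qed.

(* [v + c x] and [v - c x] are opposite convex combinations of [v + d x] and [v - d x]. *)
Lemma rad_mean_sq_symmetric_le f a v x c d : Rabs c <= Rabs d ->
  rad_mean_sq f a (badd X v (bscal X c x)) + rad_mean_sq f a (badd X v (bscal X (- c) x))
  <= rad_mean_sq f a (badd X v (bscal X d x)) + rad_mean_sq f a (badd X v (bscal X (- d) x)).
Proof.
  intros Hcd.
  destruct (Rabs_le_factor c d Hcd) as [k [Hk ->]].
  assert (Hcomb : forall s, badd X v (bscal X ((2 * s - 1) * d) x)
    = badd X (bscal X s (badd X v (bscal X d x)))
             (bscal X (1 - s) (badd X v (bscal X (- d) x)))).
  { intros s; rewrite !bscal_distr_l, badd_interchange, !bscal_assoc, <- !bscal_distr_r.
    rewrite Rplus_minus, bscal_one; do 2 f_equal; ring. }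
  assert (Hplus := rad_mean_sq_convex f a (badd X v (bscal X d x))
                     (badd X v (bscal X (- d) x)) ((1 + k) / 2) ltac:(lra)).
  assert (Hminus := rad_mean_sq_convex f a (badd X v (bscal X d x))
                      (badd X v (bscal X (- d) x)) ((1 - k) / 2) ltac:(lra)).
  rewrite <- !Hcomb in Hplus, Hminus.
  replace (2 * ((1 + k) / 2) - 1) with k in Hplus by field.
  replace ((2 * ((1 - k) / 2) - 1) * d) with (- (k * d)) in Hminus by field.
  lra.
Qed.

Lemma rad_mean_sq_contraction f a b v :
  (forall i x, In (i, x) f -> x = bzero X \/ Rabs (a i) <= Rabs (b i)) ->
  rad_mean_sq f a v <= rad_mean_sq f b v.
Proof.
  revert v; induction f as [| [i x] f IH]; intros v Hab; cbn [rad_mean_sq]; [lra |].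
  assert (IHv := fun w => IH w (fun j y Hy => Hab j y (or_intror Hy))).
  assert (Hplus := IHv (badd X v (bscal X (a i) x))).
  assert (Hminus := IHv (badd X v (bscal X (- a i) x))).
  destruct (Hab i x (or_introl eq_refl)) as [-> | Hi].
  - rewrite !bscal_bzero in *; lra.
  - assert (Hsym := rad_mean_sq_symmetric_le f b v x _ _ Hi); lra.
Qed.

Lemma rad_norm_contraction f a b :
  (forall i x, In (i, x) f -> x = bzero X \/ Rabs (a i) <= Rabs (b i)) ->
  rad_norm f a <= rad_norm f b.
Proof. intros Hab; apply sqrt_le_1_alt, rad_mean_sq_contraction, Hab. Qed.

Lemma rad_norm_le f a b : (forall i, Rabs (a i) <= Rabs (b i)) -> rad_norm f a <= rad_norm f b.
Proof. intros Hab; apply rad_norm_contraction; auto. Qed.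

Lemma rad_norm_0 f : rad_norm f (fun _ => 0) = 0.
Proof.
  rewrite <- (Rmult_0_l (rad_norm f (fun _ => 0))), <- Rabs_R0 at 1.
  rewrite <- rad_norm_scal, Rmult_0_l; reflexivity.
Qed.

Lemma le_rad_mean_sq f a v : bnorm X v ^ 2 <= rad_mean_sq f a v.
Proof.
  revert v; induction f as [| [i x] f IH]; intros v; cbn [rad_mean_sq]; [lra |].
  assert (Hsym := rad_mean_sq_symmetric_le f a v x 0 (a i)
                    ltac:(rewrite Rabs_R0; apply Rabs_pos)).
  rewrite Ropp_0, bscal_0_l, badd_zero_r in Hsym; specialize (IH v); lra.
Qed.

Lemma bnorm_le_rad_norm f a i x : In (i, x) f -> Rabs (a i) * bnorm X x <= rad_norm f a.
Proof.
  intros Hin; rewrite <- bnorm_scal, <- (sqrt_pow2 (bnorm X _)) by apply bnorm_nonneg.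
  apply sqrt_le_1_alt; induction f as [| [j y] f IH]; [destruct Hin |].
  cbn [rad_mean_sq]; destruct Hin as [E | Hin].
  - injection E as -> ->; rewrite !badd_zero_l.
    assert (Hplus := le_rad_mean_sq f a (bscal X (a i) x)).
    assert (Hminus := le_rad_mean_sq f a (bscal X (- a i) x)).
    rewrite !bnorm_scal, ?Rabs_Ropp in *; lra.
  - assert (Hsym := rad_mean_sq_symmetric_le f a (bzero X) y 0 (a j)
                      ltac:(rewrite Rabs_R0; apply Rabs_pos)).
    rewrite Ropp_0, bscal_0_l, (badd_zero_l X (bzero X)) in Hsym; specialize (IH Hin); lra.
Qed.
End Rademacher.

Lemma rad_norm_map {X : BanachSpace} {A B : Type} (k : A -> B) (c : A -> R)
  (f : list (A * X)) (a : B -> R) :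
  rad_norm (map (fun ix => (k (fst ix), bscal X (c (fst ix)) (snd ix))) f) a
  = rad_norm f (fun i => a (k i) * c i).
Proof.
  unfold rad_norm; f_equal; generalize (bzero X).
  induction f as [| [i x] f IH]; intros v; simpl; [reflexivity |].
  rewrite !IH, !bscal_assoc, Ropp_mult_distr_l; reflexivity.
Qed.

(** * Summation by parts along levels *)

Section LevelNorm.
Context {X : BanachSpace} {A : Type} (f : list (A * X)) (lev : A -> nat) (h : A -> R).

Definition level_norm (n : nat) : R :=
  rad_norm f (fun i => if (lev i <? n)%nat then h i else 0).

Lemma level_norm_nonneg n : 0 <= level_norm n.
Proof. apply rad_norm_nonneg. Qed.

Lemma level_norm_0 : level_norm 0 = 0.
Proof. apply rad_norm_0. Qed.

Lemma level_norm_le n m : (n <= m)%nat -> level_norm n <= level_norm m.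
Proof.
  intros Hnm; apply rad_norm_le; intros i.
  destruct (Nat.ltb_spec (lev i) n), (Nat.ltb_spec (lev i) m);
    rewrite ?Rabs_R0; try apply Rabs_pos; lra || lia.
Qed.

(* The weight [w (lev i)] is [w n] plus [w (lev i) - w n]; the latter vanishes on level [n]
   and has the primitive [V - w n * level_norm].  The weight is only required to decrease
   where the level norm is positive because [rpow 0 (a - 1) = 0]. *)
Lemma rad_norm_summation_by_parts n (w V : nat -> R) :
  (forall j k, (j <= k < n)%nat -> 0 < level_norm (S j) -> 0 <= w k <= w j) ->
  (forall k, (k < n)%nat -> w k * (level_norm (S k) - level_norm k) <= V (S k) - V k) ->
  rad_norm f (fun i => if (lev i <? n)%nat then w (lev i) * h i else 0) <= V n - V 0%nat.
Proof.
  revert w V; induction n as [| n IH]; intros w V Hw HV.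
  { rewrite Rminus_diag; apply Req_le, rad_norm_0. }
  assert (Htail : rad_norm f (fun i => if (lev i <? n)%nat then (w (lev i) - w n) * h i else 0)
                  <= V n - w n * level_norm n - V 0%nat).
  { specialize (IH (fun k => w k - w n) (fun k => V k - w n * level_norm k)).
    cbv beta in IH; rewrite level_norm_0, Rmult_0_r, Rminus_0_r in IH; apply IH.
    - intros j k Hjk Hj.
      assert (Hk := Rlt_le_trans _ _ _ Hj (level_norm_le (S j) (S k) ltac:(lia))).
      assert (Hwjk := Hw j k ltac:(lia) Hj); assert (Hwkn := Hw k n ltac:(lia) Hk); lra.
    - intros k Hk; specialize (HV k ltac:(lia)); lra. }
  assert (Habs : Rabs (w n) * level_norm (S n) = w n * level_norm (S n)).
  { destruct (level_norm_nonneg (S n)) as [Hpos | <-]; [| ring].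
    rewrite Rabs_pos_eq; [reflexivity | apply (Hw n n); auto]. }
  eapply Rle_trans with (rad_norm f (fun i => w n * (if (lev i <? S n)%nat then h i else 0)
    + (if (lev i <? n)%nat then (w (lev i) - w n) * h i else 0))).
  - apply rad_norm_le; intros i; apply Req_le; f_equal.
    destruct (Nat.ltb_spec (lev i) (S n)), (Nat.ltb_spec (lev i) n); try ring; try lia.
    replace (lev i) with n by lia; ring.
  - eapply Rle_trans; [apply rad_norm_triangle |].
    rewrite rad_norm_scal; fold (level_norm (S n)); rewrite Habs.
    specialize (HV n (Nat.lt_succ_diag_r n)); lra.
Qed.

Lemma rad_norm_level_power_le n (a : R) : 0 < a <= 1 ->
  rad_norm f (fun i => if (lev i <? n)%nat
                       then a * rpow (level_norm (S (lev i))) (a - 1) * h i else 0)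
  <= rpow (level_norm n) a.
Proof.
  intros Ha.
  assert (Hsum := rad_norm_summation_by_parts n
    (fun k => a * rpow (level_norm (S k)) (a - 1)) (fun k => rpow (level_norm k) a)).
  cbv beta in Hsum; rewrite level_norm_0, (rpow_nonpos_eq 0), Rminus_0_r in Hsum by lra.
  apply Hsum.
  - intros j k Hjk Hj; split.
    + apply Rmult_le_pos; [lra | apply rpow_nonneg].
    + apply Rmult_le_compat_l; [lra |].
      apply rpow_nonpos_exponent_le; [lra | split; [assumption | apply level_norm_le; lia]].
  - intros k _; apply rpow_tangent; [split | lra].
    + apply level_norm_nonneg.
    + apply level_norm_le; lia.
Qed.
End LevelNorm.

(** * Haar series *)

Section HaarSeries.
Context {X : BanachSpace}.
Implicit Types (f : haar_series X) (k : dyad -> dyad) (c : dyad -> R) (t : R).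

Lemma Rsum_map_flat_map_signs (F : list R -> R) (l : list (list R)) :
  Rsum (map F (flat_map (fun s => [1 :: s; -1 :: s]) l))
  = Rsum (map (fun s => F (1 :: s)) l) + Rsum (map (fun s => F (-1 :: s)) l).
Proof. induction l as [| s l IH]; simpl; [| rewrite IH]; ring. Qed.

Lemma mean_signed_eval f t v :
  Rsum (map (fun eps => bnorm X (badd X v (signed_eval X f eps t)) ^ 2)
            (sign_lists (length f))) / 2 ^ length f
  = rad_mean_sq f (fun I => haar I t) v.
Proof.
  revert v; induction f as [| [I x] f IH]; intros v.
  { simpl; rewrite badd_zero_r; field. }
  cbn [length sign_lists rad_mean_sq]; rewrite Rsum_map_flat_map_signs, <- !IH.
  assert (Hhead : forall e d, e * haar I t = d ->
    Rsum (map (fun s => bnorm X (badd X v (signed_eval X ((I, x) :: f) (e :: s) t)) ^ 2)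
              (sign_lists (length f)))
    = Rsum (map (fun s => bnorm X (badd X (badd X v (bscal X d x)) (signed_eval X f s t)) ^ 2)
              (sign_lists (length f)))).
  { intros e d <-; f_equal; apply map_ext; intros s; rewrite <- badd_assoc; reflexivity. }
  rewrite (Hhead 1 (haar I t)), (Hhead (-1) (- haar I t)) by ring.
  simpl (2 ^ S _); field; apply Rgt_not_eq, pow2_pos.
Qed.

Lemma Sfun_rad_norm f t : Sfun X f t = rad_norm f (fun I => haar I t).
Proof.
  unfold Sfun, rad_norm; rewrite <- mean_signed_eval; do 3 f_equal.
  apply map_ext; intros eps; rewrite badd_zero_l; reflexivity.
Qed.

Lemma Sfun_nonneg f t : 0 <= Sfun X f t.
Proof. apply sqrt_pos. Qed.

Definition haar_multiplier k c f : haar_series X :=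
  map (fun Ix => (k (fst Ix), bscal X (c (fst Ix)) (snd Ix))) f.

Lemma haar_multiplier_support k c f : map fst (haar_multiplier k c f) = map k (map fst f).
Proof. unfold haar_multiplier; rewrite !map_map; reflexivity. Qed.

Lemma Sfun_haar_multiplier k c f t :
  Sfun X (haar_multiplier k c f) t = rad_norm f (fun I => haar (k I) t * c I).
Proof.
  rewrite Sfun_rad_norm; apply (rad_norm_map k c f (fun I => haar I t)).
Qed.

Lemma rearr_haar_multiplier (tau : dyad -> dyad) r f :
  rearr X tau r f = haar_multiplier tau (fun I => rpow (dlen I / dlen (tau I)) (/ r)) f.
Proof. reflexivity. Qed.
End HaarSeries.

(** * Stopped square functions *)

Section Stopping.
Context {X : BanachSpace} (f : haar_series X).

Definition stopped_Sfun (n : nat) (t : R) : R :=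
  level_norm f dlev (fun I => haar I t) n.

Definition stopped_norm (I : dyad) : R := stopped_Sfun (S (dlev I)) (dleft I).

Lemma stopped_Sfun_eq I t : in_dyadb I t = true ->
  stopped_Sfun (S (dlev I)) t = stopped_norm I.
Proof.
  intros Ht; apply Rle_antisym; apply rad_norm_le; intros J;
    destruct (Nat.ltb_spec (dlev J) (S (dlev I))) as [HJ | HJ]; try lra;
    rewrite !abs_haar;
    rewrite (in_dyadb_same_interval I J t (dleft I)) by (auto using in_dyadb_dleft; lia); lra.
Qed.

Lemma stopped_Sfun_le_Sfun n t : stopped_Sfun n t <= Sfun X f t.
Proof.
  rewrite Sfun_rad_norm; apply rad_norm_le; intros I.
  destruct (dlev I <? n)%nat; [lra | rewrite Rabs_R0; apply Rabs_pos].
Qed.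

Lemma stopped_norm_nonneg I : 0 <= stopped_norm I.
Proof. apply level_norm_nonneg. Qed.

Lemma stopped_norm_le_Sfun I t : in_dyadb I t = true -> stopped_norm I <= Sfun X f t.
Proof. intros Ht; rewrite <- (stopped_Sfun_eq I t Ht); apply stopped_Sfun_le_Sfun. Qed.

Lemma bnorm_le_stopped_norm I x : In (I, x) f -> bnorm X x <= stopped_norm I.
Proof.
  intros Hin; eapply Rle_trans; [| apply (bnorm_le_rad_norm f _ I x Hin)].
  cbv beta; rewrite (proj2 (Nat.ltb_lt _ _) (Nat.lt_succ_diag_r _)).
  rewrite abs_haar, in_dyadb_dleft; lra.
Qed.

Definition stopped_weight (a : R) (I : dyad) : R := a * rpow (stopped_norm I) (a - 1).

Definition reweighted (a : R) : haar_series X :=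
  haar_multiplier (fun I => I) (stopped_weight a) f.

Lemma reweighted_support a : map fst (reweighted a) = map fst f.
Proof. unfold reweighted; rewrite haar_multiplier_support; apply map_id. Qed.

Lemma Sfun_reweighted_le a t : 0 < a <= 1 ->
  Sfun X (reweighted a) t <= rpow (Sfun X f t) a.
Proof.
  intros Ha; set (n := S (maxlev (map fst f))).
  apply Rle_trans with (rpow (stopped_Sfun n t) a);
    [| apply rpow_le; [lra | apply stopped_Sfun_le_Sfun]].
  eapply Rle_trans; [| apply rad_norm_level_power_le; assumption].
  unfold reweighted; rewrite Sfun_haar_multiplier.
  apply rad_norm_contraction; intros I x Hx; right; cbv beta.
  apply (in_map fst), dlev_le_maxlev in Hx; simpl in Hx.
  destruct (Nat.ltb_spec (dlev I) n) as [_ | Hlev]; [| unfold n in Hlev; lia].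
  rewrite Rmult_comm, !(Rabs_mult _ (haar I t)), abs_haar.
  destruct (in_dyadb I t) eqn:Ht; [| lra].
  unfold stopped_weight; rewrite <- (stopped_Sfun_eq I t Ht); apply Rle_refl.
Qed.
End Stopping.

(** * Dyadic maximal functions *)

Section DyadicSup.
Context {A : Type}.
Implicit Types (k : A -> dyad) (w s : A -> R) (G : list A) (c d t : R).

Definition dyadic_sup k w G t : R :=
  fold_right Rmax 0 (map (fun i => if in_dyadb (k i) t then w i else 0) G).

Lemma dyadic_sup_nonneg k w G t : 0 <= dyadic_sup k w G t.
Proof.
  unfold dyadic_sup; induction G as [| i G IH]; simpl; [lra |].
  eapply Rle_trans; [apply IH | apply Rmax_r].
Qed.

Lemma le_dyadic_sup k w G t i : In i G -> in_dyadb (k i) t = true -> w i <= dyadic_sup k w G t.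
Proof.
  intros Hi Ht; unfold dyadic_sup; induction G as [| j G IH]; simpl; [destruct Hi |].
  destruct Hi as [-> | Hi]; [rewrite Ht; apply Rmax_l |].
  eapply Rle_trans; [apply IH, Hi | apply Rmax_r].
Qed.

Lemma dyadic_sup_le k w G t B : 0 <= B ->
  (forall i, In i G -> in_dyadb (k i) t = true -> w i <= B) -> dyadic_sup k w G t <= B.
Proof.
  intros HB Hw; unfold dyadic_sup; induction G as [| i G IH]; simpl; [assumption |].
  apply Rmax_lub; [| apply IH; intros; apply Hw; simpl; auto].
  destruct (in_dyadb (k i) t) eqn:Ht; [apply Hw; simpl; auto | assumption].
Qed.

Lemma dyadic_sup_step k w G m : (maxlev (map k G) <= m)%nat ->
  dyadic_step m (dyadic_sup k w G).
Proof.
  intros Hm t u Htu; unfold dyadic_sup; f_equal; apply map_ext_in; intros i Hi.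
  rewrite (in_dyadb_same_cell (k i) m t u); [reflexivity | | assumption].
  apply (in_map k), dlev_le_maxlev in Hi; lia.
Qed.

Definition superlevel s c G : list A :=
  filter (fun i => if Rlt_dec c (s i) then true else false) G.

Lemma in_superlevel s c G i : In i (superlevel s c G) <-> In i G /\ c < s i.
Proof.
  unfold superlevel; rewrite filter_In.
  destruct (Rlt_dec c (s i)); intuition discriminate.
Qed.

Definition excess s c (i : A) : R := Rmax 0 (s i - c).

Lemma dyadic_sup_excess_le k w s c d G t :
  (forall i, 0 <= w i) -> c <= d ->
  dyadic_sup k (fun i => excess s c i * w i) G t
  <= (d - c) * dyadic_sup k w (superlevel s c G) t
     + dyadic_sup k (fun i => excess s d i * w i) G t.
Proof.
  intros Hw Hcd.
  assert (Hlayer := dyadic_sup_nonneg k w (superlevel s c G) t).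
  assert (Hrest := dyadic_sup_nonneg k (fun i => excess s d i * w i) G t).
  apply (Rmult_le_compat_l (d - c)) in Hlayer; [| lra]; rewrite Rmult_0_r in Hlayer.
  apply dyadic_sup_le; [lra |]; intros i Hi Ht.
  destruct (Rlt_le_dec c (s i)) as [Hc | Hc].
  - assert (Hi_layer := le_dyadic_sup k w (superlevel s c G) t i
                          (proj2 (in_superlevel s c G i) (conj Hi Hc)) Ht).
    assert (Hi_rest := le_dyadic_sup k (fun i => excess s d i * w i) G t i Hi Ht).
    apply (Rmult_le_compat_l (d - c)) in Hi_layer; [| lra].
    assert (Hsplit : excess s c i * w i <= ((d - c) + excess s d i) * w i)
      by (apply Rmult_le_compat_r; [apply Hw | unfold excess, Rmax];
          destruct (Rle_dec _ _), (Rle_dec _ _); lra).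
    cbv beta in Hi_rest; lra.
  - unfold excess at 1; rewrite Rmax_left, Rmult_0_l by lra; lra.
Qed.

Lemma dyadic_sup_excess_ge k s c d G t :
  c < d -> (forall i, In i G -> c < s i -> d <= s i) ->
  (d - c) * dyadic_sup k (fun _ => 1) (superlevel s c G) t + dyadic_sup k (excess s d) G t
  <= dyadic_sup k (excess s c) G t.
Proof.
  intros Hcd Hgap.
  set (B := dyadic_sup k (excess s c) G t).
  set (u := dyadic_sup k (fun _ => 1) (superlevel s c G) t).
  assert (HB : 0 <= B) by apply dyadic_sup_nonneg.
  assert (Hu : u <= 1) by (apply dyadic_sup_le; intros; lra).
  assert (Hexcess : forall i, In i G -> in_dyadb (k i) t = true -> s i - c <= B).
  { intros i Hi Ht; eapply Rle_trans; [apply (Rmax_r 0) |].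
    apply (le_dyadic_sup k (excess s c) G t i Hi Ht). }
  assert (Hlayer : (d - c) * u <= B).
  { apply (Rmult_le_reg_l (/ (d - c))); [apply Rinv_0_lt_compat; lra |].
    rewrite <- Rmult_assoc, Rinv_l, Rmult_1_l by lra.
    apply dyadic_sup_le; [apply Rmult_le_pos; [left; apply Rinv_0_lt_compat |]; lra |].
    intros i Hi Ht; apply in_superlevel in Hi; destruct Hi as [Hi Hc].
    apply (Rmult_le_reg_l (d - c)); [lra |].
    rewrite <- Rmult_assoc, Rinv_r by lra.
    specialize (Hgap i Hi Hc); specialize (Hexcess i Hi Ht); lra. }
  apply Rplus_le_reg_l with (- ((d - c) * u)); rewrite <- Rplus_assoc, Rplus_opp_l, Rplus_0_l.
  apply dyadic_sup_le; [lra |]; intros i Hi Ht; apply Rmax_lub; [lra |].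
  specialize (Hexcess i Hi Ht).
  assert ((d - c) * u <= (d - c) * 1) by (apply Rmult_le_compat_l; lra); lra.
Qed.

Lemma exists_argmin s G : G <> [] -> exists i, In i G /\ forall j, In j G -> s i <= s j.
Proof.
  intros HG; set (l := map (fun i => - s i) G).
  assert (Hmax : In (MaxRlist l) l).
  { apply MaxRlist_P2; destruct G as [| i G]; [tauto | exists (- s i); left; reflexivity]. }
  apply in_map_iff in Hmax; destruct Hmax as [i [Hi HiG]]; exists i; split; [assumption |].
  intros j Hj; apply Ropp_le_cancel; rewrite Hi.
  apply MaxRlist_P1, (in_map (fun i => - s i)), Hj.
Qed.

Lemma next_value_ind s G (P : R -> Prop) :
  (forall c, (forall i, In i G -> s i <= c) -> P c) ->
  (forall c i, In i G -> c < s i -> (forall j, In j G -> c < s j -> s i <= s j) ->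
     P (s i) -> P c) ->
  forall c, P c.
Proof.
  intros Htop Hnext.
  assert (Hvalues : forall n values, (length values < n)%nat ->
    forall c, (forall i, In i G -> c < s i -> In (s i) values) -> P c).
  { induction n as [| n IH]; intros values Hn c Hc; [lia |].
    destruct (superlevel s c G) as [| j layer] eqn:E.
    - apply Htop; intros i Hi; apply Rnot_lt_le; intros Hlt.
      assert (Hin := proj2 (in_superlevel s c G i) (conj Hi Hlt)); rewrite E in Hin; destruct Hin.
    - destruct (exists_argmin s (superlevel s c G)) as [i [Hi Hmin]]; [congruence |].
      apply in_superlevel in Hi; destruct Hi as [Hi Hlt].
      apply (Hnext c i Hi Hlt).
      + intros l Hl Hcl; apply Hmin, in_superlevel; auto.
      + apply (IH (remove Req_dec_T (s i) values)).
        * assert (Hlen := remove_length_lt Req_dec_T values (s i) (Hc i Hi Hlt)); lia.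
        * intros l Hl Hil; apply in_in_remove; [lra | apply Hc; [assumption | lra]]. }
  intros c; apply (Hvalues _ (map s G) (Nat.lt_succ_diag_r _)); intros i Hi _; apply in_map, Hi.
Qed.
End DyadicSup.

(** * The constant [C_1] *)

Lemma union_indicator_eq (G : list dyad) t :
  (if existsb (fun I => in_dyadb I t) G then 1 else 0)
  = dyadic_sup (fun I => I) (fun _ => 1) G t.
Proof.
  destruct (existsb (fun I => in_dyadb I t) G) eqn:E.
  - apply existsb_exists in E; destruct E as [I [HI Ht]]; apply Rle_antisym.
    + apply (le_dyadic_sup (fun I => I) (fun _ => 1) G t I HI Ht).
    + apply dyadic_sup_le; intros; lra.
  - apply Rle_antisym; [apply dyadic_sup_nonneg |].
    apply dyadic_sup_le; [lra |]; intros I HI Ht.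
    rewrite (proj2 (existsb_exists _ _) (ex_intro _ I (conj HI Ht))) in E; discriminate.
Qed.

Lemma union_meas_dyadic_sup (G : list dyad) m : (maxlev G <= m)%nat ->
  union_meas G = dyadic_int m (dyadic_sup (fun I => I) (fun _ => 1) G).
Proof.
  intros Hm; rewrite (dyadic_int_refine (maxlev G) m); [| | assumption].
  - unfold union_meas, dyadic_int; f_equal; apply map_ext; intros j.
    rewrite union_indicator_eq; reflexivity.
  - apply dyadic_sup_step; rewrite map_id; apply le_n.
Qed.

Lemma union_meas_pos (G : list dyad) : G <> [] -> 0 < union_meas G.
Proof.
  destruct G as [| I G]; intros HG; [tauto |].
  eapply Rlt_le_trans; [apply (dlen_pos I) |].
  eapply Rle_trans; [apply (dlen_le_dyadic_int_indicator I (maxlev (I :: G))) |].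
  - apply dlev_le_maxlev; left; reflexivity.
  - apply dyadic_int_le; intros t; cbn [existsb].
    destruct (in_dyadb I t), (existsb _ G); simpl; lra.
Qed.

Lemma mu_nonneg tau G t : 0 <= mu tau G t.
Proof. apply (dyadic_sup_nonneg tau (fun I => dlen I / dlen (tau I))). Qed.

Section Carleson.
Variables (tau : dyad -> dyad) (M : R).
Hypothesis HM : C1_bound tau M.

Lemma C1_bound_nonneg : 0 <= M.
Proof.
  set (I := mkDyad 0 0 eq_refl).
  eapply Rle_trans; [| apply (HM [I])]; [| discriminate].
  apply Rle_mult_inv_pos; [| apply union_meas_pos; discriminate].
  apply dyadic_int_nonneg, mu_nonneg.
Qed.

Lemma C1_bound_mu_le G m m' : (maxlev G <= m)%nat -> (maxlev (map tau G) <= m')%nat ->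
  dyadic_int m' (mu tau G) <= M * dyadic_int m (dyadic_sup (fun I => I) (fun _ => 1) G).
Proof.
  intros Hm Hm'; rewrite <- (union_meas_dyadic_sup G m Hm).
  rewrite (dyadic_int_refine (maxlev (map tau G)));
    [| apply (dyadic_sup_step tau (fun I => dlen I / dlen (tau I))), le_n | assumption].
  destruct G as [| I G].
  - apply Req_le; unfold union_meas, dyadic_int, mu; simpl; field.
  - assert (Hu := union_meas_pos (I :: G) ltac:(discriminate)).
    assert (HC := HM (I :: G) ltac:(discriminate)).
    apply (Rmult_le_compat_r (union_meas (I :: G))) in HC; [| lra].
    unfold Rdiv in HC; rewrite Rmult_assoc, Rinv_l, Rmult_1_r in HC by lra; assumption.
Qed.

Lemma C1_bound_excess (s : dyad -> R) G m m' c :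
  (maxlev G <= m)%nat -> (maxlev (map tau G) <= m')%nat ->
  dyadic_int m' (dyadic_sup tau (fun I => excess s c I * (dlen I / dlen (tau I))) G)
  <= M * dyadic_int m (dyadic_sup (fun I => I) (excess s c) G).
Proof.
  intros Hm Hm'; assert (HM0 := C1_bound_nonneg).
  revert c; apply (next_value_ind s G).
  - intros c Htop; apply Rle_trans with 0.
    + set (g := dyadic_sup _ _ G).
      rewrite <- (Rmult_0_l (dyadic_int m' g)), <- dyadic_int_scal.
      apply dyadic_int_le; intros t; rewrite Rmult_0_l.
      apply dyadic_sup_le; [lra |]; intros I HI _; specialize (Htop I HI).
      unfold excess; rewrite Rmax_left by lra; lra.
    + apply Rmult_le_pos; [assumption | apply dyadic_int_nonneg, dyadic_sup_nonneg].
  - intros c J _ Hc Hgap IH.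
    assert (Hincl : incl (superlevel s c G) G) by apply incl_filter.
    (* From level [c] to the next value [s J] the suprema lose exactly the layer [{s > c}]. *)
    assert (Hlayer := C1_bound_mu_le (superlevel s c G) m m'
      ltac:(eapply Nat.le_trans; [apply maxlev_incl, Hincl | assumption])
      ltac:(eapply Nat.le_trans; [apply maxlev_incl, incl_map, Hincl | assumption])).
    apply (Rmult_le_compat_l (s J - c)) in Hlayer; [| lra].
    eapply Rle_trans; [apply dyadic_int_le; intros t; apply (dyadic_sup_excess_le tau) |].
    + intros I; left; apply dlen_ratio_pos.
    + apply Rlt_le, Hc.
    + rewrite dyadic_int_plus, dyadic_int_scal.
      eapply Rle_trans; [apply Rplus_le_compat; [apply Hlayer | apply IH] |].
      rewrite <- Rmult_assoc, (Rmult_comm _ M), Rmult_assoc, <- Rmult_plus_distr_l.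
      rewrite <- dyadic_int_scal, <- dyadic_int_plus.
      apply Rmult_le_compat_l; [assumption |].
      apply dyadic_int_le; intros t; apply dyadic_sup_excess_ge; assumption.
Qed.

Lemma C1_bound_layer_cake (s : dyad -> R) G m m' : (forall I, In I G -> 0 <= s I) ->
  (maxlev G <= m)%nat -> (maxlev (map tau G) <= m')%nat ->
  dyadic_int m' (dyadic_sup tau (fun I => s I * (dlen I / dlen (tau I))) G)
  <= M * dyadic_int m (dyadic_sup (fun I => I) s G).
Proof.
  intros Hs Hm Hm'.
  assert (Hexcess : forall I, In I G -> excess s 0 I = s I)
    by (intros I HI; unfold excess; rewrite Rminus_0_r; apply Rmax_right, Hs, HI).
  eapply Rle_trans; [| eapply Rle_trans; [apply (C1_bound_excess s G m m' 0 Hm Hm') |]].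
  - apply dyadic_int_le; intros t; apply dyadic_sup_le; [apply dyadic_sup_nonneg |].
    intros I HI Ht; rewrite <- Hexcess by assumption.
    apply (le_dyadic_sup tau (fun I => excess s 0 I * _) G t I HI Ht).
  - apply Rmult_le_compat_l; [apply C1_bound_nonneg |].
    apply dyadic_int_le; intros t; apply dyadic_sup_le; [apply dyadic_sup_nonneg |].
    intros I HI Ht; rewrite Hexcess by assumption; apply (le_dyadic_sup (fun I => I) s G t I HI Ht).
Qed.
End Carleson.

(** * Extrapolation *)

Lemma exponent_ratio_bounds (q p : R) : 0 < q -> q <= p -> 0 < q / p <= 1.
Proof.
  intros Hq Hqp; split; [apply Rdiv_lt_0_compat; lra |].
  apply (Rmult_le_reg_r p); [lra |]; unfold Rdiv; rewrite Rmult_assoc, Rinv_l; lra.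
Qed.

Lemma exponent_gap_nonneg (q p : R) : 0 < q -> q <= p -> 0 <= / q - / p.
Proof. intros Hq Hqp; assert (/ p <= / q) by (apply Rinv_le_contravar; lra); lra. Qed.

Lemma rpow_interpolation (q p s r N : R) : 0 < q -> q <= p -> 0 < s -> 0 <= r ->
  rpow s q * r <= N ->
  rpow r (/ q) <= rpow N (/ q - / p) * (rpow s (q / p - 1) * rpow r (/ p)).
Proof.
  intros Hq Hqp Hs Hr HN.
  apply (rpow_le _ _ _ (exponent_gap_nonneg q p Hq Hqp)) in HN.
  rewrite rpow_mult_distr, rpow_rpow in HN by (try apply rpow_nonneg; assumption).
  apply (Rmult_le_compat_r (rpow s (q / p - 1) * rpow r (/ p))) in HN;
    [| apply Rmult_le_pos; apply rpow_nonneg].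
  eapply Rle_trans; [apply Req_le | apply HN].
  replace (/ q) with (/ q - / p + / p) at 1 by ring; rewrite rpow_plus.
  replace (q * (/ q - / p)) with (- (q / p - 1)) by (field; lra).
  assert (Hcancel : rpow s (- (q / p - 1)) * rpow s (q / p - 1) = 1)
    by (rewrite <- rpow_plus, Rplus_opp_l; apply rpow_0_r; assumption).
  transitivity (rpow r (/ q - / p) * rpow r (/ p)
                * (rpow s (- (q / p - 1)) * rpow s (q / p - 1)));
    [rewrite Hcancel |]; ring.
Qed.

Section Extrapolation.
Context {X : BanachSpace} (tau : dyad -> dyad) (q p : R).
Hypotheses (Hq : 0 < q) (Hqp : q <= p).
Variable f : haar_series X.

Lemma Hnorm_reweighted_le : Hnorm X p (reweighted f (q / p)) <= rpow (Hnorm X q f) (q / p).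
Proof.
  unfold Hnorm; rewrite reweighted_support, rpow_rpow.
  replace (/ q * (q / p)) with (/ p) by (field; lra).
  apply rpow_le; [left; apply Rinv_0_lt_compat; lra | apply dyadic_int_le; intros t].
  eapply Rle_trans.
  - apply rpow_le; [lra | apply Sfun_reweighted_le, exponent_ratio_bounds; assumption].
  - rewrite rpow_rpow; apply Req_le; f_equal; field; lra.
Qed.

Definition rearr_mass : R -> R :=
  dyadic_sup tau (fun I => rpow (stopped_norm f I) q * (dlen I / dlen (tau I))) (map fst f).

Lemma Sfun_rearr_le t :
  Sfun X (rearr X tau q f) t
  <= p / q * (rpow (rearr_mass t) (/ q - / p) * Sfun X (rearr X tau p (reweighted f (q / p))) t).
Proof.
  rewrite !rearr_haar_multiplier, !Sfun_haar_multiplier.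
  unfold reweighted, haar_multiplier.
  rewrite (rad_norm_map (fun I => I) (stopped_weight f (q / p)) f).
  rewrite <- Rmult_assoc.
  rewrite <- (Rabs_pos_eq (p / q * _)), <- rad_norm_scal
    by (apply Rmult_le_pos; [left; apply Rdiv_lt_0_compat; lra | apply rpow_nonneg]).
  apply rad_norm_contraction; intros I x Hx.
  assert (Hr := dlen_ratio_pos I (tau I)); set (r := dlen I / dlen (tau I)) in *.
  destruct (stopped_norm_nonneg f I) as [Hs | Hs].
  2: { left; apply bnorm_eq0, Rle_antisym; [| apply bnorm_nonneg].
       rewrite Hs; apply (bnorm_le_stopped_norm f I x Hx). }
  right; replace (p / q * rpow (rearr_mass t) (/ q - / p)
                  * (haar (tau I) t * rpow r (/ p) * stopped_weight f (q / p) I))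
    with (haar (tau I) t * (rpow (rearr_mass t) (/ q - / p)
            * (rpow (stopped_norm f I) (q / p - 1) * rpow r (/ p))))
    by (unfold stopped_weight; field; lra).
  rewrite !(Rabs_mult (haar (tau I) t)), abs_haar.
  destruct (in_dyadb (tau I) t) eqn:Ht; [| lra].
  assert (Hle : rpow r (/ q) <= rpow (rearr_mass t) (/ q - / p)
            * (rpow (stopped_norm f I) (q / p - 1) * rpow r (/ p))).
  { apply rpow_interpolation; try assumption; [lra |].
    apply (le_dyadic_sup tau (fun I => rpow (stopped_norm f I) q * (dlen I / dlen (tau I))));
      [apply (in_map fst _ _ Hx) | assumption]. }
  assert (Hpos := rpow_nonneg r (/ q)).
  rewrite !Rabs_pos_eq; lra.
Qed.

Lemma rearr_mass_int_le M : C1_bound tau M ->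
  dyadic_int (S (maxlev (map tau (map fst f)))) rearr_mass <= M * rpow (Hnorm X q f) q.
Proof.
  intros HM; unfold Hnorm; rewrite rpow_rpow, Rinv_l, rpow_1_r
    by (lra || (apply dyadic_int_nonneg; intros; apply rpow_nonneg)).
  eapply Rle_trans.
  - apply (C1_bound_layer_cake tau M HM (fun I => rpow (stopped_norm f I) q) (map fst f)
             (S (maxlev (map fst f)))); auto using rpow_nonneg.
  - apply Rmult_le_compat_l; [apply (C1_bound_nonneg tau M HM) |].
    apply dyadic_int_le; intros t; apply dyadic_sup_le; [apply rpow_nonneg |].
    intros I _ Ht; apply rpow_le; [lra | apply stopped_norm_le_Sfun; assumption].
Qed.

Lemma Hnorm_rearr_le_mass :
  Hnorm X q (rearr X tau q f)
  <= p / q * rpow (dyadic_int (S (maxlev (map tau (map fst f)))) rearr_mass) (/ q - / p)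
     * Hnorm X p (rearr X tau p (reweighted f (q / p))).
Proof.
  assert (Hsupp : forall r g, map fst (rearr X tau r g) = map tau (map fst g))
    by (intros r g; rewrite rearr_haar_multiplier; apply haar_multiplier_support).
  unfold Hnorm; rewrite !Hsupp, reweighted_support.
  set (m := S (maxlev _)); set (T := Sfun X (rearr X tau p _)).
  assert (Hpq : 0 <= p / q) by (left; apply Rdiv_lt_0_compat; lra).
  assert (Hratio := exponent_ratio_bounds q p Hq Hqp).
  assert (HT : forall t, 0 <= T t) by (intros; apply Sfun_nonneg).
  assert (HTp : forall t, 0 <= rpow (T t) p) by (intros; apply rpow_nonneg).
  assert (Hmass : forall t, 0 <= rearr_mass t) by (intros; apply dyadic_sup_nonneg).
  assert (Hint : dyadic_int m (fun t => rpow (Sfun X (rearr X tau q f) t) q)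
    <= rpow (p / q) q * (rpow (dyadic_int m rearr_mass) (1 - q / p)
                         * rpow (dyadic_int m (fun t => rpow (T t) p)) (q / p))).
  { eapply Rle_trans; [apply dyadic_int_le; intros t; apply rpow_le; [lra | apply Sfun_rearr_le] |].
    eapply Rle_trans; [| apply Rmult_le_compat_l;
      [apply rpow_nonneg | apply dyadic_int_holder; auto; lra]].
    rewrite <- dyadic_int_scal; apply dyadic_int_le; intros t; fold (T t).
    rewrite !rpow_mult_distr, !rpow_rpow by (auto using Rmult_le_pos, rpow_nonneg).
    replace ((/ q - / p) * q) with (1 - q / p) by (field; lra).
    replace (p * (q / p)) with q by (field; lra); lra. }
  apply (rpow_le _ _ (/ q)) in Hint; [| left; apply Rinv_0_lt_compat; lra].
  eapply Rle_trans; [apply Hint | apply Req_le].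
  rewrite !rpow_mult_distr, !rpow_rpow by (auto using Rmult_le_pos, rpow_nonneg).
  replace ((1 - q / p) * / q) with (/ q - / p) by (field; lra).
  replace (q / p * / q) with (/ p) by (field; lra).
  rewrite Rinv_r, rpow_1_r by lra; ring.
Qed.
Lemma Hnorm_rearr_le M : C1_bound tau M ->
  Hnorm X q (rearr X tau q f)
  <= p / q * (rpow M (/ q - / p) * rpow (Hnorm X q f) (1 - q / p))
     * Hnorm X p (rearr X tau p (reweighted f (q / p))).
Proof.
  intros HM; eapply Rle_trans; [apply Hnorm_rearr_le_mass |].
  apply Rmult_le_compat_r; [apply rpow_nonneg |].
  apply Rmult_le_compat_l; [left; apply Rdiv_lt_0_compat; lra |].
  replace (1 - q / p) with (q * (/ q - / p)) by (field; lra).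
  rewrite <- rpow_rpow, <- rpow_mult_distr
    by (apply rpow_nonneg || apply (C1_bound_nonneg tau M HM)).
  apply rpow_le; [apply exponent_gap_nonneg | apply rearr_mass_int_le]; assumption.
Qed.
End Extrapolation.

Theorem theorem1 :
  forall q : R, 0 < q ->
  exists A : R, 0 < A /\
    forall (X : BanachSpace) (tau : dyad -> dyad),
      (forall I J, tau I = tau J -> I = J) ->
      forall p : R, q <= p -> p <= 2 ->
      forall M1 Mp : R,
        C1_bound tau M1 ->
        opbound X tau p Mp ->
        opbound X tau q (A * Rpower M1 (/ q - / p) * Mp).
Proof.
  intros q Hq; exists (2 / q); split; [apply Rdiv_lt_0_compat; lra |].
  intros X tau _ p Hqp Hp M1 Mp HM1 HMp f Hvalid Hf.
  assert (Hratio := exponent_ratio_bounds q p Hq Hqp).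
  assert (Hpow_le_1 : forall a, 0 <= a -> rpow (Hnorm X q f) a <= 1)
    by (intros a Ha; rewrite <- (rpow_1_l a); apply rpow_le; assumption).
  assert (HTg : Hnorm X p (rearr X tau p (reweighted f (q / p))) <= Mp).
  { apply HMp; [unfold valid_series; rewrite reweighted_support; assumption |].
    eapply Rle_trans; [apply Hnorm_reweighted_le; assumption | apply Hpow_le_1; lra]. }
  eapply Rle_trans; [apply (Hnorm_rearr_le tau q p Hq Hqp f M1 HM1) |].
  rewrite <- (Rmult_1_r (Rpower M1 _)).
  assert (Hinv := Rinv_0_lt_compat q Hq).
  apply Rmult_le_compat; [| apply rpow_nonneg | | assumption].
  - repeat apply Rmult_le_pos; apply rpow_nonneg || lra.
  - apply Rmult_le_compat; [apply Rmult_le_pos; lra | | apply Rmult_le_compat_r; lra |].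
    + apply Rmult_le_pos; apply rpow_nonneg.
    + apply Rmult_le_compat; try apply rpow_nonneg; [apply rpow_le_Rpower | apply Hpow_le_1; lra].
Qed.
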